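(* For every $n>0$, the $H$-triangle $H_n(x,y)$ associated with the Hochschild lattice $\mathrm{Hoch}(n)$ satisfies $$H_n(x,y)=\sum_{u\in\mathrm{Tri}(n)}x^{|\mathrm{Can}(u)|}y^{\mathrm{neg}(u)}.$$
   Context: Hochschild lattice. For $n\geq 1$, a triword of length $n$ is a tuple $u=(u_1,\ldots,u_n)$ such that (T1) $u_i\in\{0,1,2\}$ for all $i$; (T2) $u_1\neq 2$; (T3) if $u_i=0$, then $u_j\neq 1$ for all $j>i$. Let $\mathrm{Tri}(n)$ be the set of all triwords of length $n$. The Hochschild lattice is $\mathrm{Hoch}(n)=(\mathrm{Tri}(n),\leq)$ where $\leq$ is the componentwise order. It is known to be a semidistributive lattice: the join is the componentwise maximum, and the meet is obtained by taking the componentwise minimum and then replacing by $0$ every entry $1$ that has an entry $0$ somewhere to its left. Labels, canonical join representations, core label order. Let $L$ be a finite semidistributive lattice. For a cover relation $a\lessdot b$ put $\lambda(a,b)=\min\{c\in L\mid a\vee c=b\}$; this minimum exists and is join irreducible. The canonical join representation of $a\in L$ is $\mathrm{Can}(a)=\{\lambda(b,a)\mid b\lessdot a\}$ (equivalently, the antichain with join $a$ that refines every subset with join $a$). The nucleus of $a$ is $a_\downarrow=a\wedge\bigwedge_{b\lessdot a}b$. The core label set of $a$ is $\Psi(a)=\{\lambda(b,b')\mid a_\downarrow\leq b\lessdot b'\leq a\}$. The map $a\mapsto\Psi(a)$ is injective. The core label order $\mathrm{CLO}(L)$ is the poset $(L,\sqsubseteq)$ where $a\sqsubseteq b$ if and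 only if $\Psi(a)\subseteq\Psi(b)$. $H$-triangle. The poset $\mathrm{CLO}(\mathrm{Hoch}(n))$ is graded with least element $(0,\ldots,0)$; let $\mathrm{rk}$ be its rank function (so $\mathrm{rk}(0,\ldots,0)=0$) and $\mu_n$ its Möbius function (with $\mu_n(u,v)=0$ if $u\not\sqsubseteq v$). Define $$M_n(x,y)=\sum_{u,v\in\mathrm{Tri}(n)}\mu_n(u,v)\,x^{\mathrm{rk}(u)}y^{\mathrm{rk}(v)},\qquad H_n(x,y)=\bigl(x(y-1)+1\bigr)^n M_n\left(\frac{y}{y-1},\frac{x(y-1)}{x(y-1)+1}\right).$$ Atoms. Let $\mathrm{Atom}(n)$ be the set of atoms of $\mathrm{Hoch}(n)$, i.e. of elements covering $(0,\ldots,0)$. Explicitly, these are $(1,0,\ldots,0)$ and, for $2\leq i\leq n$, the tuple with a $2$ in position $i$ and zeros elsewhere. For $u\in\mathrm{Tri}(n)$ let $\mathrm{neg}(u)=|\mathrm{Can}(u)\cap\mathrm{Atom}(n)|$, where $\mathrm{Can}(u)$ is taken in $\mathrm{Hoch}(n)$. *)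

(* Defs.v *)
From HB Require Import structures.
From mathcomp Require Import all_boot all_order all_algebra.

Set Implicit Arguments.
Unset Strict Implicit.
Unset Printing Implicit Defensive.

Import Order.TTheory GRing.Theory.

Local Open Scope order_scope.

Section FinPOrder.
Context {d : Order.disp_t} {T : finPOrderType d}.
Implicit Types x y z : T.

Definition covers x y : bool := (x < y) && [forall z, ~~ (x < z < y)].

(* The length of a longest chain with all its elements below [x]; in a graded
   poset with a least element this is the rank of [x]. *)
Definition rank x : nat :=
  (\max_(C : {set T} |
       [forall y in C, (y <= x)%O && [forall z in C, (y >=< z)%O]]) #|C|.-1)%N.

(* [k] bounds the depth of the recursion; [mobiusE] below shows that [#|T|] is
   large enough for the defining recursion of the Moebius function to hold. *)
Fixpoint mobius_rec (k : nat) x y : int :=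
  if k is k'.+1 then
    if x == y then 1%R
    else if x <= y then (- \sum_(z : T | (x <= z < y)%O) mobius_rec k' x z)%R
    else 0%R
  else 0%R.

Definition mobius x y : int := mobius_rec #|T| x y.

Lemma mobius_recE k x y :
  (#|[set z | (x <= z < y)%O]| < k)%N ->
  mobius_rec k x y = mobius_rec #|[set z | (x <= z < y)%O]|.+1 x y.
Proof.
have [m] := ubnP #|[set z | (x <= z < y)%O]|.
elim: m k y => // m IH [|k] // y lem ltk /=.
case: eqP => // _; case: ifP => // lexy; congr (- _)%R.
apply: eq_bigr => z /andP[lexz ltzy].
have ltc : (#|[set t | (x <= t < z)%O]| < #|[set t | (x <= t < y)%O]|)%N.
  apply: proper_card; apply/properP; split.
    apply/subsetP => t; rewrite !inE => /andP[-> /= ltt].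
    exact: lt_trans ltt ltzy.
  by exists z; rewrite !inE ?lexz ?ltzy // ltxx andbF.
have ltm := leq_trans ltc lem.
rewrite (IH k) ?(IH #|[set t | (x <= t < y)%O]|) //.
by apply: leq_trans ltc _.
Qed.

Lemma mobiusE x y :
  mobius x y =
    if x == y then 1%R
    else if x <= y then (- \sum_(z : T | (x <= z < y)%O) mobius x z)%R
    else 0%R.
Proof.
have bnd z : (#|[set t | (x <= t < z)%O]| < #|T|)%N.
  rewrite -cardsT; apply: proper_card; apply/properP; split; first exact/subsetP.
  by exists z; rewrite ?inE // ltxx andbF.
rewrite /mobius mobius_recE //.
rewrite -(@mobius_recE #|T|.+1) /=; last exact: leqW.
by [].
Qed.

End FinPOrder.

Definition atoms {d : Order.disp_t} (L : finTBLatticeType d) : {set L} :=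
  [set a | covers \bot a].

Definition join_semidistributive {d : Order.disp_t} (L : latticeType d) : Prop :=
  forall a b c : L, a `|` b = a `|` c -> a `|` (b `&` c) = a `|` b.

Section Labels.
Context {d : Order.disp_t} {L : finLatticeType d}.
Implicit Types a b c j : L.

(* [j] is the minimum of the set of all [c] with [a `|` c = b]. *)
Definition is_label a b j : bool :=
  (a `|` j == b) && [forall c, (a `|` c == b) ==> (j <= c)].

Definition Can a : {set L} :=
  [set j | [exists b, covers b a && is_label b a j]].

Definition nucleus a : L := \big[Order.meet/a]_(b | covers b a) b.

Definition Psi a : {set L} :=
  [set j | [exists b, exists b',
     [&& nucleus a <= b, covers b b', b' <= a & is_label b b' j]]].

Lemma label_exists a b :
  join_semidistributive L -> a <= b -> exists j, is_label a b j.
Proof.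
move=> sd leab.
have ajb : a `|` b = b by exact: join_r.
pose j := \big[Order.meet/b]_(c | a `|` c == b) c.
exists j; apply/andP; split.
  rewrite /j; elim/big_rec: _ => [|c x /eqP ac /eqP ax]; first by rewrite ajb.
  by rewrite sd ac // ax.
apply/forallP => c; apply/implyP => ac.
by rewrite /j (bigD1 c) //= leIl.
Qed.

Lemma nucleus_le a b : covers b a -> nucleus a <= b.
Proof. by move=> cov; rewrite /nucleus (bigD1 b) //= leIl. Qed.

Lemma lower_cover a c : c < a -> exists2 b, covers b a & c <= b.
Proof.
have [m] := ubnP #|[set z | (c < z < a)%O]|.
elim: m c => // m IH c lem ltca.
case: (boolP [forall z, ~~ (c < z < a)]) => [nob|].
  by exists c => //; rewrite /covers ltca.
case/forallPn => z; rewrite negbK => /andP[ltcz ltza].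
have [|b cov lezb] := IH z _ ltza; last first.
  by exists b => //; apply: le_trans lezb; exact: ltW.
rewrite ltnS in lem; apply: leq_trans lem; apply: proper_card.
apply/properP; split.
  by apply/subsetP => t; rewrite !inE => /andP[/(lt_trans ltcz) -> ->].
by exists z; rewrite !inE ?ltcz ?ltza // ltxx.
Qed.

Lemma Psi_inj : join_semidistributive L -> injective Psi.
Proof.
move=> sd.
have le_Psi a b : Psi a \subset Psi b -> a <= b.
  move=> sub; apply/negbNE/negP => nle.
  have : a `&` b < a.
    by rewrite lt_neqAle leIl andbT; apply: contra nle => /eqP <-; exact: leIr.
  case/lower_cover => c cov lec.
  have ltca : c < a by case/andP: cov.
  have [j labj] := label_exists sd (ltW ltca).
  have : j \in Psi a.
    rewrite inE; apply/existsP; exists c; apply/existsP; exists a.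
    by rewrite nucleus_le // cov lexx labj.
  case/andP: labj => /eqP cj _.
  move/(subsetP sub); rewrite inE => /existsP[x] /existsP[y].
  case/and4P => _ _ leyb /andP[/eqP xj _].
  have lejb : j <= b by apply: le_trans leyb; rewrite -xj leUr.
  have leja : j <= a by rewrite -cj leUr.
  have lejc : j <= c by apply: le_trans lec; rewrite lexI leja lejb.
  by move: ltca; rewrite -cj (join_l lejc) ltxx.
move=> a b eqab; apply/le_anti.
by rewrite !le_Psi // eqab.
Qed.

End Labels.

(* Positions are counted from [0], so the first letter is the one at [0]. *)
Definition triword {n : nat} (u : n.-tuple 'I_3) : bool :=
  [forall i : 'I_n, (i == 0 :> nat) ==> (tnth u i != 2 :> nat)] &&
  [forall i : 'I_n, forall j : 'I_n,
     (i < j)%N && (tnth u i == 0 :> nat) ==> (tnth u j != 1 :> nat)].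

Record hoch (n : nat) := Hoch {
  hoch_val :> n.-tuple 'I_3;
  hochP : triword hoch_val
}.

HB.instance Definition _ (n : nat) := [isSub for @hoch_val n].
HB.instance Definition _ (n : nat) := [Finite of hoch n by <:].

Section Hochschild.
Context {n : nat}.
Implicit Types u v w : hoch n.

Lemma hoch_first u (i : 'I_n) : i = 0 :> nat -> (tnth u i != 2 :> nat).
Proof.
by move=> i0; case/andP: (hochP u) => /forallP/(_ i); rewrite i0 eqxx.
Qed.

Lemma hoch_after0 u (i j : 'I_n) :
  (i < j)%N -> tnth u i = 0 :> nat -> (tnth u j != 1 :> nat).
Proof.
move=> ij ui0; case/andP: (hochP u) => _ /forallP/(_ i)/forallP/(_ j).
by rewrite ij ui0 eqxx.
Qed.

Lemma hoch_eqP u v : (forall i, tnth u i = tnth v i) -> u = v.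
Proof. by move=> uv; apply/val_inj/eq_from_tnth. Qed.

Definition hoch_le u v : bool := [forall i, tnth u i <= tnth v i].

Lemma hoch_le_refl : reflexive hoch_le.
Proof. by move=> u; apply/forallP => i. Qed.

Lemma hoch_le_anti : antisymmetric hoch_le.
Proof.
move=> u v /andP[/forallP uv /forallP vu]; apply: hoch_eqP => i.
by apply/le_anti; rewrite uv vu.
Qed.

Lemma hoch_le_trans : transitive hoch_le.
Proof.
move=> v u w /forallP uv /forallP vw; apply/forallP => i.
exact: le_trans (uv i) (vw i).
Qed.

Definition word_min u v (i : 'I_n) : 'I_3 := Order.min (tnth u i) (tnth v i).

Definition hoch_meet_word u v : n.-tuple 'I_3 :=
  [tuple if (word_min u v i == 1 :> nat)
            && [exists j : 'I_n, (j < i)%N && (word_min u v j == 0 :> nat)]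
         then ord0 else word_min u v i | i < n].

Definition hoch_join_word u v : n.-tuple 'I_3 :=
  [tuple Order.max (tnth u i) (tnth v i) | i < n].

Lemma hoch_meet_subproof u v : triword (hoch_meet_word u v).
Proof.
apply/andP; split.
  apply/forallP => i; apply/implyP => /eqP i0; rewrite tnth_mktuple.
  case: ifP => // _; rewrite /word_min minEle.
  by case: ifP => _; exact: hoch_first.
apply/forallP => i; apply/forallP => j; apply/implyP => /andP[ij].
rewrite !tnth_mktuple; case: (ifP (_ && _)) => [/andP[_ /existsP[k /andP[ki mk]]] _|_ mi].
  case: ifP => // /negP nj; apply/negP => mj; case: nj; rewrite mj /=.
  by apply/existsP; exists k; rewrite (ltn_trans ki ij) mk.
case: ifP => // /negP nj; apply/negP => mj; case: nj; rewrite mj /=.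
by apply/existsP; exists i; rewrite ij mi.
Qed.

Lemma hoch_join_subproof u v : triword (hoch_join_word u v).
Proof.
apply/andP; split.
  apply/forallP => i; apply/implyP => /eqP i0; rewrite tnth_mktuple maxEle.
  by case: ifP => _; exact: hoch_first.
apply/forallP => i; apply/forallP => j; apply/implyP => /andP[ij].
rewrite !tnth_mktuple => m0.
have leu : (tnth u i <= Order.max (tnth u i) (tnth v i)) by rewrite le_max lexx.
have lev : (tnth v i <= Order.max (tnth u i) (tnth v i)).
  by rewrite le_max lexx orbT.
have ui : tnth u i = 0 :> nat by move: leu; rewrite leEord (eqP m0) leqn0 => /eqP.
have vi : tnth v i = 0 :> nat by move: lev; rewrite leEord (eqP m0) leqn0 => /eqP.
by rewrite maxEle; case: ifP => _; [exact: hoch_after0 vi|exact: hoch_after0 ui].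
Qed.

Definition hoch_meet u v : hoch n := Hoch (hoch_meet_subproof u v).
Definition hoch_join u v : hoch n := Hoch (hoch_join_subproof u v).

Lemma hoch_meetP u v w : hoch_le u (hoch_meet v w) = hoch_le u v && hoch_le u w.
Proof.
apply/forallP/andP => [le|[/forallP lev /forallP lew] i].
  have lem i : tnth u i <= word_min v w i.
    by apply: le_trans (le i) _; rewrite tnth_mktuple; case: ifP.
  by split; apply/forallP => i; move: (lem i); rewrite le_min => /andP[].
have lem k : tnth u k <= word_min v w k by rewrite le_min lev lew.
rewrite tnth_mktuple; case: ifP => // /andP[/eqP mi /existsP[j /andP[ji /eqP mj]]].
have uj : tnth u j = 0 :> nat by have := lem j; rewrite leEord mj leqn0 => /eqP.
have := lem i; rewrite !leEord mi /= => ui1.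
by have := hoch_after0 ji uj; case: (tnth u i : nat) ui1 => [|[]].
Qed.

Lemma hoch_joinP u v w : hoch_le (hoch_join u v) w = hoch_le u w && hoch_le v w.
Proof.
apply/forallP/andP => [le|[/forallP leu /forallP lev] i].
  by split; apply/forallP => i; move: (le i); rewrite tnth_mktuple ge_max => /andP[].
by rewrite tnth_mktuple ge_max leu lev.
Qed.

Lemma hoch_bottom_subproof : triword [tuple ord0 : 'I_3 | i < n].
Proof.
apply/andP; split; apply/forallP => i; first by rewrite tnth_mktuple implybT.
by apply/forallP => j; rewrite !tnth_mktuple implybT.
Qed.

Lemma hoch_top_subproof :
  triword [tuple (inord (if i == 0 :> nat then 1 else 2) : 'I_3) | i < n].
Proof.
apply/andP; split; apply/forallP => i.
  by apply/implyP => /eqP i0; rewrite tnth_mktuple i0 /= inordK.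
apply/forallP => j; apply/implyP; rewrite !tnth_mktuple => /andP[_].
by case: ifP => _; rewrite inordK.
Qed.

Definition hoch_bottom : hoch n := Hoch hoch_bottom_subproof.
Definition hoch_top : hoch n := Hoch hoch_top_subproof.

Lemma hoch_bottomP u : hoch_le hoch_bottom u.
Proof. by apply/forallP => i; rewrite tnth_mktuple leEord. Qed.

Lemma hoch_topP u : hoch_le u hoch_top.
Proof.
apply/forallP => i; rewrite tnth_mktuple leEord.
case: eqP => i0; rewrite inordK //; last by rewrite -ltnS.
have := hoch_first u i0; have := ltn_ord (tnth u i).
by case: (tnth u i : nat) => [|[|[|]]].
Qed.

End Hochschild.

Fact hoch_display : Order.disp_t. Proof. exact: Order.Disp tt tt. Qed.

HB.instance Definition _ (n : nat) :=
  Order.Le_isPOrder.Build hoch_display (hoch n)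
    (@hoch_le_refl n) (@hoch_le_anti n) (@hoch_le_trans n).
HB.instance Definition _ (n : nat) :=
  Order.POrder_MeetJoin_isLattice.Build hoch_display (hoch n)
    (@hoch_meetP n) (@hoch_joinP n).
HB.instance Definition _ (n : nat) :=
  Order.hasBottom.Build hoch_display (hoch n) (@hoch_bottomP n).
HB.instance Definition _ (n : nat) :=
  Order.hasTop.Build hoch_display (hoch n) (@hoch_topP n).

Lemma hoch_join_semidistributive n : join_semidistributive (hoch n).
Proof.
move=> a b c eqabc; apply: hoch_eqP => i.
have maxi : Order.max (tnth a i) (tnth b i) = Order.max (tnth a i) (tnth c i).
  have := congr1 (fun w : hoch n => tnth w i) eqabc.
  by rewrite /= !tnth_mktuple.
rewrite /= !tnth_mktuple; case: ifPn => [/andP[mi /existsP[j /andP[ji mj]]]|_].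
  suff ai : tnth a i = 2 :> nat.
    have ub (t : 'I_3) : t <= tnth a i by rewrite leEord ai -ltnS.
    by rewrite !max_l.
  have val_max (s t : 'I_3) : Order.max s t = maxn s t :> nat.
    by rewrite maxEle leEord; case: leqP.
  have val_min (s t : 'I_3) : Order.min s t = minn s t :> nat.
    by rewrite minEle leEord; case: leqP.
  move/(congr1 (@nat_of_ord 3)): maxi; rewrite !val_max => maxi.
  move: mi mj; rewrite /word_min !val_min => /eqP mi /eqP mj.
  have bj := @hoch_after0 _ b _ _ ji; have cj := @hoch_after0 _ c _ _ ji.
  have b1c1 : tnth b i != 1 :> nat \/ tnth c i != 1 :> nat.
    have [ltbc|lecb] := ltnP (tnth b j) (tnth c j).
      by left; apply: bj; move: mj; rewrite (minn_idPl (ltnW ltbc)).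
    by right; apply: cj; move: mj; rewrite (minn_idPr lecb).
  move: (ltn_ord (tnth a i)) (ltn_ord (tnth b i)) (ltn_ord (tnth c i)).
  move: maxi mi b1c1; clear.
  move: (tnth a i : nat) (tnth b i : nat) (tnth c i : nat).
  by case=> [|[|[|?]]] // [|[|[|?]]] // [|[|[|?]]] // _ _ [].
by rewrite /word_min; case: (leP (tnth b i) (tnth c i)).
Qed.

(* The core label order: the elements of [hoch n], ordered by inclusion of
   core label sets. *)
Definition clo (n : nat) : Type := hoch n.
HB.instance Definition _ (n : nat) := Finite.on (clo n).

Definition clo_le {n : nat} (u v : clo n) : bool :=
  Psi (u : hoch n) \subset Psi (v : hoch n).

Lemma clo_le_refl n : reflexive (@clo_le n).
Proof. by move=> u; exact: subxx. Qed.

Lemma clo_le_anti n : antisymmetric (@clo_le n).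
Proof.
move=> u v; rewrite -eqEsubset => /eqP.
exact/Psi_inj/hoch_join_semidistributive.
Qed.

Lemma clo_le_trans n : transitive (@clo_le n).
Proof. by move=> v u w; exact: subset_trans. Qed.

Fact clo_display : Order.disp_t. Proof. exact: Order.Disp tt tt. Qed.

HB.instance Definition _ (n : nat) :=
  Order.Le_isPOrder.Build clo_display (clo n)
    (@clo_le_refl n) (@clo_le_anti n) (@clo_le_trans n).

Definition neg {n : nat} (u : hoch n) : nat := #|Can u :&: atoms (hoch n)|.

Local Open Scope ring_scope.

Definition Mtriangle {R : comNzRingType} (n : nat) (x y : R) : R :=
  \sum_(u : clo n) \sum_(v : clo n)
    (mobius u v)%:~R * x ^+ rank u * y ^+ rank v.

Definition Htriangle {F : fieldType} (n : nat) (x y : F) : F :=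
  (x * (y - 1) + 1) ^+ n *
  Mtriangle n (y / (y - 1)) (x * (y - 1) / (x * (y - 1) + 1)).

(* The field of rational functions Q(x, y), as the fraction field of Z[x][y]. *)
Definition ratfun : fieldType := {fraction {poly {poly int}}}.
Definition varx : ratfun := FracField.tofrac ('X%:P : {poly {poly int}}).
Definition vary : ratfun := FracField.tofrac ('X : {poly {poly int}}).

(* Main.v *)
(* Write A for the set of positions of the letters 2 of a triword u, and, when
   u starts with 1, let I be the interval from its last letter 1 up to, but
   excluding, its first letter 0; let I be empty when u starts with 0.  Then Psi u
   consists of one atom for each element of A and of one word 1...10...0 for
   each element of I, so the core label order is inclusion of the pairs (A, I),
   and rk u = |Can u| = |A| + [u_1 <> 0].

   The Moebius function is never computed.  By Moebius inversion,
   sum_u mu(u, v) t^rk(u) is the only family chi_v whose sum over the ideal of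
   v is t^rk(v), and chi_v = (t - 1)^|A| if u_1 = 0, and
   (t - 1)^|A| (t - |I|) otherwise, works.  All sums over an ideal become sums
   over subsets because the pairs (w, i) with w below v and i in the interval
   of w correspond to the pairs (B, i) with B inside the set A of v and i in
   the interval I of v.  Both sides of the identity turn out to be
   (1 + x y)^n + (n - 1) x (1 + x y)^(n - 2). *)

Require Import Defs.
From mathcomp Require Import all_boot all_order all_algebra.
From mathcomp Require Import zify ring.

Set Implicit Arguments.
Unset Strict Implicit.
Unset Printing Implicit Defensive.

Import Order.TTheory GRing.Theory.

(** * Words, covers and labels *)

Section Words.
Context {n : nat}.
Implicit Types (u v w : hoch n.+1) (i j k : 'I_n.+1) (B : {set 'I_n.+1}).

Definition letter u i : nat := tnth u i.

Lemma letter_lt3 u i : letter u i < 3. Proof. exact: ltn_ord. Qed.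

Lemma letter_ord0 u : letter u ord0 <= 1.
Proof.
have := @hoch_first _ u ord0 erefl; have := letter_lt3 u ord0.
by rewrite -/(letter u ord0); case: (letter _ _) => [|[|[|]]].
Qed.

Lemma letter_after0 u i j : i < j -> letter u i = 0 -> letter u j <> 1.
Proof. by move=> ij /(hoch_after0 ij)/eqP. Qed.

Lemma letter_inj u v : letter u =1 letter v -> u = v.
Proof. by move=> uv; apply: hoch_eqP => i; apply/val_inj/uv. Qed.

Lemma hoch_leP u v : reflect (forall i, letter u i <= letter v i) (u <= v)%O.
Proof. exact: forallP. Qed.

Lemma letter_join u v i :
  letter (u `|` v)%O i = maxn (letter u i) (letter v i).
Proof. by rewrite /letter tnth_mktuple maxEle leEord; case: leqP. Qed.

Lemma letter_bot i : letter (\bot)%O i = 0.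
Proof. by rewrite /letter tnth_mktuple. Qed.

(** The default [\bot] makes this total; the letters are those of [f] only under [valid f]. *)
Definition word (f : 'I_n.+1 -> nat) : hoch n.+1 :=
  insubd (\bot%O : hoch n.+1) [tuple inord (f i) : 'I_3 | i < n.+1].

Definition valid (f : 'I_n.+1 -> nat) : Prop :=
  [/\ f ord0 <= 1, forall i, f i < 3 &
      forall i j, i < j -> f i = 0 -> f j <> 1].

Lemma letter_word f i : valid f -> letter (word f) i = f i.
Proof.
case=> f0 f3 f01; rewrite /letter /word /insubd insubT /=.
  apply/andP; split; apply/forallP => j.
    apply/implyP => /eqP j0; rewrite tnth_mktuple inordK //.
    by rewrite (_ : j = ord0) ?neq_ltn ?ltnS ?f0 //; apply: val_inj.
  apply/forallP => k; rewrite !tnth_mktuple !inordK //.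
  by apply/implyP => /andP[jk /eqP/(f01 _ _ jk)/eqP].
by move=> ?; rewrite tnth_mktuple inordK.
Qed.

Definition unmarked_word B : hoch n.+1 :=
  word (fun j => if j \in B then 2 else 0).

Definition marked_word B i : hoch n.+1 :=
  word (fun j => if j \in B then 2 else (j <= i : nat)).

Lemma letter_unmarked B i : ord0 \notin B ->
  letter (unmarked_word B) i = if i \in B then 2 else 0.
Proof.
move=> B0; apply: (letter_word i); split=> [|j|j k jk]; last by do 2!case: ifP.
  by rewrite (negbTE B0).
by case: ifP.
Qed.

Lemma letter_marked B i j : ord0 \notin B ->
  letter (marked_word B i) j = if j \in B then 2 else (j <= i : nat).
Proof.
move=> B0; apply: (letter_word j); split=> [|k|k l kl]; first by rewrite (negbTE B0).
  by case: (k \in B) => //=; case: (k <= i).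
case: ifP => // _; case: ifP => // _.
by case: leqP => // ik _; rewrite leqNgt (ltn_trans ik kl).
Qed.

(* [twos u] and [block u] are the sets A and I described above. *)
Definition twos u : {set 'I_n.+1} := [set i | letter u i == 2].

Definition block u : {set 'I_n.+1} :=
  [set i : 'I_n.+1 | [forall j : 'I_n.+1, letter u j != (i < j)]].

Lemma twos0 u : ord0 \notin twos u.
Proof. by rewrite inE; have := letter_ord0 u; case: (letter _ _) => [|[|]]. Qed.

(** The truth value [i < j] stands for a letter: 0 is excluded at positions up to [i] and 1 after
    [i], so [i] runs from the last 1 to just before the first 0. *)
Lemma blockP u i : reflect (forall j, letter u j <> (i < j)) (i \in block u).
Proof. by rewrite inE; apply: (iffP forallP) => H j; apply/eqP; have /eqP := H j. Qed.

Lemma twosE u i : (i \in twos u) = (letter u i == 2).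
Proof. by rewrite inE. Qed.

(** Off [twos u], positions up to [i] carry 1 and later ones 0. So A and a single element of I
    determine the word. *)
Lemma block_letter u i : i \in block u -> u = marked_word (twos u) i.
Proof.
move=> /blockP bi; apply: letter_inj => j; rewrite letter_marked ?twos0 // twosE.
move: (bi j) (letter_lt3 u j); case: (letter u j) => [|[|[|]]] //=.
  by case: leqP.
by case: leqP.
Qed.

Lemma unmarked_letter u : letter u ord0 = 0 -> u = unmarked_word (twos u).
Proof.
move=> u0; apply: letter_inj => i; rewrite letter_unmarked ?twos0 // twosE.
have [->|i0] := eqVneq i ord0; first by rewrite u0.
have := @letter_after0 u ord0 i; rewrite lt0n => /(_ i0 u0).
by move: (letter_lt3 u i); case: (letter u i) => [|[|[|]]].
Qed.

Lemma twos_unmarked B : ord0 \notin B -> twos (unmarked_word B) = B.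
Proof. by move=> B0; apply/setP => i; rewrite twosE letter_unmarked //; case: ifP. Qed.

Lemma twos_marked B i : ord0 \notin B -> twos (marked_word B i) = B.
Proof.
move=> B0; apply/setP => j; rewrite twosE letter_marked //.
by case: ifP => //; case: leqP.
Qed.

(** The interval I carries letters 1 and 2 only, and its only letter 1 is the last one of the
    word. *)
Lemma last_one u : letter u ord0 != 0 -> exists l, block u :\: twos u = [set l].
Proof.
move=> u0; have u01 : letter u ord0 == 1.
  by rewrite eqn_leq letter_ord0 lt0n.
case: (@arg_maxnP _ ord0 (fun i => letter u i == 1) val u01) => l /eqP ul lmax.
have lb : l \in block u.
  apply/blockP => j; case: ltnP => [lj uj|lj].
    have jl : j <= l by apply: lmax; rewrite uj.
    by rewrite leqNgt lj in jl.
  move: lj; rewrite leq_eqVlt => /predU1P[/val_inj ->|lj]; first by rewrite ul.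
  by move=> /(letter_after0 lj).
exists l; apply/setP => i; rewrite in_setD in_set1 twosE.
apply/andP/eqP => [[ui /blockP ib]|-> //]; last by rewrite ul.
have ui1 : letter u i = 1.
  by move: ui (letter_lt3 u i) (ib i); rewrite ltnn; case: (letter u i) => [|[|[|]]].
apply/val_inj/eqP; rewrite eqn_leq; apply/andP; split.
  by apply: lmax; rewrite ui1.
by rewrite leqNgt; apply/negP => il; have := ib l; rewrite il ul.
Qed.

Lemma block_eq0 u : (block u == set0) = (letter u ord0 == 0).
Proof.
have [u0|/last_one[l ul]] := eqVneq (letter u ord0) 0.
  by apply/eqP/setP => i; rewrite in_set0; apply/blockP => /(_ ord0); rewrite u0.
apply/negbTE/set0Pn; exists l.
by have := set11 l; rewrite -ul => /setDP[].
Qed.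

Lemma card_blockD u : #|block u :\: twos u| = (letter u ord0 != 0).
Proof.
have [/eqP|/last_one[l ->]] := eqVneq (letter u ord0) 0; last by rewrite cards1.
by rewrite -block_eq0 => /eqP ->; rewrite set0D cards0.
Qed.

Lemma mem_block_marked B i : ord0 \notin B -> i \in block (marked_word B i).
Proof.
by move=> B0; apply/blockP => j; rewrite letter_marked //; case: ifP => _; case: ltnP.
Qed.

(** At [ord0] the prescribed letters are not [valid] and the value is [\bot]; hence the hypotheses
    [i != ord0] below. *)
Definition atom_word i : hoch n.+1 := unmarked_word [set i].
Definition stair i : hoch n.+1 := marked_word set0 i.

Lemma letter_atom i j : i != ord0 -> letter (atom_word i) j = if j == i then 2 else 0.
Proof. by move=> i0; rewrite letter_unmarked in_set1 // eq_sym. Qed.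

Lemma letter_stair i j : letter (stair i) j = (j <= i).
Proof. by rewrite letter_marked inE. Qed.

Lemma atom_inj : {in [pred i | i != ord0] &, injective atom_word}.
Proof.
move=> i j i0 j0 /(congr1 twos); rewrite !twos_unmarked ?in_set1 1?eq_sym //.
exact: set1_inj.
Qed.

Lemma stair_inj : injective stair.
Proof.
move=> i j eqij; apply/val_inj/eqP; rewrite eqn_leq.
have := congr1 (letter^~ i) eqij; have := congr1 (letter^~ j) eqij.
by rewrite !letter_stair !leqnn; case: (leqP i j); case: (leqP j i).
Qed.

Lemma stair_neq_atom i j : i != ord0 -> stair j <> atom_word i.
Proof.
move=> i0 /(congr1 (letter^~ ord0)); rewrite letter_stair letter_atom //.
by rewrite eq_sym (negbTE i0).
Qed.

(** * Cover relations of triwords *)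

(* The last condition rules out a triword in between with letter 1 at [i]. *)
Definition step w w' i : Prop :=
  [/\ letter w i < letter w' i,
      forall j, j != i -> letter w j = letter w' j &
      letter w' i = 2 -> letter w i = 0 ->
        exists2 j : 'I_n.+1, j < i & letter w' j = 0].

Lemma step_le w w' i : step w w' i -> (w <= w')%O.
Proof.
case=> lti eqw _; apply/hoch_leP => j.
by have [->|/eqw ->//] := eqVneq j i; exact: ltnW.
Qed.

(** A word strictly in between agrees with both off [i] and has letter 1 there, between 0 and 2; the
    0 required before [i] forbids this. *)
Lemma step_covers w w' i : step w w' i -> covers w w'.
Proof.
move=> st; have le := step_le st; case: st => lti eqw sq.
have neq : w != w' by apply: contraTneq lti => ->; rewrite ltnn.
rewrite /covers lt_neqAle neq le; apply/forallP => z.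
apply/negP => /andP[]; rewrite !lt_neqAle => /andP[wz /hoch_leP lwz].
case/andP=> zw' /hoch_leP lzw'.
have eqz j : j != i -> letter w j = letter z j /\ letter z j = letter w' j.
  by move=> ji; have := lwz j; have := lzw' j; rewrite eqw //; lia.
have zi1 : letter w i < letter z i.
  rewrite ltn_neqAle lwz andbT; apply: contra wz => /eqP wzi.
  by apply/eqP/letter_inj => j; have [->//|/eqz[]] := eqVneq j i.
have zi2 : letter z i < letter w' i.
  rewrite ltn_neqAle lzw' andbT; apply: contra zw' => /eqP wzi.
  by apply/eqP/letter_inj => j; have [->//|/eqz[]] := eqVneq j i.
have := letter_lt3 w' i => w'3.
have [||j ji wj] := sq; [lia|lia|].
have zj : letter z j = 0 by have := lzw' j; lia.
by have := letter_after0 ji zj; lia.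
Qed.

(** If [u] has letter 1 at [i], it drops to 0 in [w]: no 1 of [w], hence of [u], follows [i], and no
    0 of [u] precedes it. *)
Lemma step_mem w u i : step w u i -> i \in twos u :|: block u.
Proof.
case=> lti eqw _; rewrite in_setU twosE; have [//|ui2/=] := eqVneq (letter u i) 2.
have u3 := letter_lt3 u i; have [wi ui] : letter w i = 0 /\ letter u i = 1 by lia.
apply/blockP => j; case: ltnP => [ij|].
  by have := letter_after0 ij wi; rewrite eqw // -(inj_eq val_inj) neq_ltn ij orbT.
rewrite leq_eqVlt => /predU1P[/val_inj ->|ji]; first by rewrite ui.
by move=> uj; have := letter_after0 ji uj; rewrite ui.
Qed.

(** For [i] in A or I, the lower cover of [u] that changes position [i]: a 2 drops to 1 where a 1 is
    permitted, otherwise directly to 0. *)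
Definition lower u i : hoch n.+1 :=
  word (fun j =>
    if j == i
    then ((letter u i == 2)
            && [forall k : 'I_n.+1, (k < i) ==> (letter u k != 0)] : nat)
    else letter u j).

Lemma letter_lower u i j : i \in twos u :|: block u ->
  letter (lower u i) j =
    if j == i
    then ((letter u i == 2)
            && [forall k : 'I_n.+1, (k < i) ==> (letter u k != 0)] : nat)
    else letter u j.
Proof.
move=> iu; apply: (letter_word j); split=> [|k|k l kl].
- by case: ifP => _; [case: andb | exact: letter_ord0].
- by case: ifP => _; [case: andb | exact: letter_lt3].
have [ki|ki] := eqVneq k i; last first.
  have [li|li] := eqVneq l i; last exact: letter_after0.
  move=> uk; case: andP => // -[_ /forallP/(_ k)]; rewrite uk.
  by rewrite -li kl.
have li : l != i by apply: contraTneq kl => ->; rewrite ki ltnn.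
rewrite (negbTE li).
(* No letter 1 may follow the new 0 at [i]: if the old letter is not 2, then [i] lies in I and
   [blockP] applies; otherwise a 0 already precedes [i]. *)
case: andP => // ni _.
have [ui|ui] := eqVneq (letter u i) 2; last first.
  move: iu; rewrite in_setU twosE (negbTE ui) => /blockP/(_ l).
  by rewrite -ki kl.
case: (boolP [forall k : 'I_n.+1, (k < i) ==> (letter u k != 0)]) => [ni'|].
  by case: ni; rewrite ui.
case/forallPn => m; rewrite negb_imply negbK => /andP[mi /eqP um].
by apply: letter_after0 um; rewrite (ltn_trans mi) // -ki.
Qed.

Lemma step_lower u i : i \in twos u :|: block u -> step (lower u i) u i.
Proof.
move=> iu; have lE := letter_lower _ iu.
split=> [|j ji|ui].
- rewrite lE eqxx; have [->|ui] := eqVneq (letter u i) 2; first by case: [forall _, _].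
  move: iu; rewrite in_setU twosE (negbTE ui) => /blockP/(_ i).
  by rewrite ltnn lt0n => /eqP.
- by rewrite lE (negbTE ji).
rewrite lE eqxx ui /=; case: (boolP [forall _, _]) => // + _.
case/forallPn => k; rewrite negb_imply negbK => /andP[ki /eqP uk].
by exists k.
Qed.

(** If [w] loses a letter 2 of [u], that position serves. Otherwise [w] turns some 1 into 0, hence
    also the last 1 of [u], since no 1 follows a 0. *)
Lemma lt_lower u w : (w < u)%O ->
  exists2 i, i \in twos u :|: block u & (w <= lower u i)%O.
Proof.
rewrite lt_neqAle => /andP[neq /hoch_leP lewu].
have [i /andP[ui wi]|no2] := pickP (fun i => (letter u i == 2) && (letter w i != 2)).
  exists i; first by rewrite in_setU twosE ui.
  apply/hoch_leP => j; rewrite letter_lower ?in_setU ?twosE ?ui //.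
  case: eqP => [->|_ //]; rewrite /=.
  case: (boolP [forall _, _]) => [_|].
    by move: wi (letter_lt3 w i); case: (letter w i) => [|[|[|]]].
  case/forallPn => k; rewrite negb_imply negbK => /andP[ki /eqP uk].
  have wk : letter w k = 0 by have := lewu k; lia.
  have := letter_after0 ki wk.
  by move: wi (letter_lt3 w i); case: (letter w i) => [|[|[|]]].
have [i wui|eqwu] := pickP (fun i => letter w i != letter u i); last first.
  by case/eqP: neq; apply: letter_inj => i; move/negbFE/eqP: (eqwu i).
have [wi ui] : letter w i = 0 /\ letter u i = 1.
  by have := no2 i; have := lewu i; have := letter_lt3 u i; lia.
have u0 : letter u ord0 != 0.
  apply/eqP => u0; have [i0|] := posnP i.
    by rewrite (_ : i = ord0) ?u0 // in ui; exact: val_inj.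
  by move=> i0; apply: (@letter_after0 u ord0 i).
have [l lu] := last_one u0.
have /setDP[lb l2] : l \in block u :\: twos u by rewrite lu set11.
exists l; first by rewrite in_setU lb orbT.
apply/hoch_leP => j; rewrite letter_lower ?in_setU ?lb ?orbT //.
case: eqP => [->|_ //]; rewrite -twosE (negbTE l2) /=.
have il : i <= l.
  by rewrite leqNgt; apply/negP => li; move/blockP/(_ i): lb; rewrite li.
have ul2 : letter u l != 2 by rewrite -twosE.
move: il; rewrite leq_eqVlt => /predU1P[/val_inj <-|il]; first by rewrite wi.
by have := letter_after0 il wi; have := lewu l; have := letter_lt3 u l; lia.
Qed.

Lemma coversE w u : covers w u -> exists2 i, i \in twos u :|: block u & w = lower u i.
Proof.
case/andP => wu /forallP nob; have [i iu le] := lt_lower wu; exists i => //.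
have := nob (lower u i); rewrite lt_neqAle le andbT.
have /step_covers/andP[-> _] := step_lower iu.
by rewrite andbT negbK => /eqP.
Qed.

(** * Labels of covers and canonical join representations *)

Definition label u i : hoch n.+1 := if i \in twos u then atom_word i else stair i.

Lemma twos_neq0 u i : i \in twos u -> i != ord0.
Proof. by apply: contraTneq => ->; exact: twos0. Qed.

(** Any word whose join with [w] is [u] must itself supply the letter of [u] at [i]. A 2 there puts
    it above [atom_word i]; a 1 excludes every 0 before [i] and puts it above [stair i]. *)
Lemma step_label w u i : step w u i -> is_label w u (label u i).
Proof.
move=> st; have iu := step_mem st; case: st => lti eqw _; rewrite /label.
have u3 := letter_lt3 u i.
case: ifPn => [iu2|nu2].
  have ui : letter u i = 2 by move: iu2; rewrite twosE => /eqP.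
  have i0 := twos_neq0 iu2.
  apply/andP; split.
    apply/eqP/letter_inj => j; rewrite letter_join letter_atom //.
    by case: eqP => [->|/eqP/eqw]; lia.
  apply/forallP => c; apply/implyP => /eqP/(congr1 (letter^~ i)) /=.
  rewrite letter_join => ci; apply/hoch_leP => j; rewrite letter_atom //.
  by case: eqP => // ->; lia.
have ui2 : letter u i != 2 by rewrite -twosE.
have [wi ui] : letter w i = 0 /\ letter u i = 1 by lia.
have before0 (v : hoch n.+1) j : letter v i = 1 -> j < i -> 0 < letter v j.
  by move=> vi ji; rewrite lt0n; apply/eqP => /(letter_after0 ji).
apply/andP; split.
  apply/eqP/letter_inj => j; rewrite letter_join letter_stair.
  have [->|ji] := eqVneq j i; first by rewrite wi ui leqnn.
  rewrite eqw //; have := before0 u j ui; move: ji; rewrite -(inj_eq val_inj) /=.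
  by lia.
apply/forallP => c; apply/implyP => /eqP/(congr1 (letter^~ i)) /=.
rewrite letter_join wi ui => ci; apply/hoch_leP => j; rewrite letter_stair.
have := before0 c j; have [->|] := eqVneq j i; first by rewrite leqnn; lia.
by rewrite -(inj_eq val_inj) /=; lia.
Qed.

Lemma is_label_uniq (a b j k : hoch n.+1) : is_label a b j -> is_label a b k -> j = k.
Proof.
case/andP => aj /forallP minj /andP[ak /forallP mink]; apply/le_anti.
by have := minj k; have := mink j; rewrite aj ak /= => -> ->.
Qed.

Lemma Can_label u : Can u = [set label u i | i in twos u :|: block u].
Proof.
apply/setP => j; rewrite inE; apply/existsP/imsetP => [[w]|[i iu ->]].
  case/andP => /coversE[i iu ->]; exists i => //.
  by apply: is_label_uniq (step_label (step_lower iu)).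
exists (lower u i); have st := step_lower iu.
by rewrite (step_covers st) step_label.
Qed.

Lemma label_inj u : injective (label u).
Proof.
move=> i j; rewrite /label.
case: ifP => [/twos_neq0 i0|_]; case: ifP => [/twos_neq0 j0|_].
- exact: atom_inj.
- by move/esym/stair_neq_atom => /(_ i0).
- by move/stair_neq_atom => /(_ j0).
exact: stair_inj.
Qed.

Definition weight u : nat := #|twos u| + (letter u ord0 != 0).

Lemma card_twosU_block u : #|twos u :|: block u| = weight u.
Proof.
rewrite /weight -card_blockD -(cardsID (twos u)) setIUl setIid setDUl setDv set0U.
by rewrite setUC (setUidPr _) // subsetIr.
Qed.

Lemma card_Can u : #|Can u| = weight u.
Proof. by rewrite Can_label card_imset ?card_twosU_block //; exact: label_inj. Qed.

Lemma atom_word_atoms i : i != ord0 -> atom_word i \in atoms (hoch n.+1).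
Proof.
move=> i0; rewrite inE; apply: (@step_covers \bot%O _ i); split.
- by rewrite letter_bot letter_atom ?eqxx.
- by move=> j ji; rewrite letter_bot letter_atom // (negbTE ji).
by exists ord0; rewrite ?lt0n // letter_atom // eq_sym (negbTE i0).
Qed.

Lemma stair_atoms i : (stair i \in atoms (hoch n.+1)) = (i == ord0).
Proof.
rewrite inE; apply/idP/eqP => [|->]; last first.
  apply: (@step_covers \bot%O _ ord0); split; rewrite ?letter_bot ?letter_stair //.
  by move=> j j0; rewrite letter_bot letter_stair leqn0
    -[nat_of_ord j == 0]/(j == ord0) (negbTE j0).
(* For [i != ord0], [stair ord0] lies strictly between [\bot] and [stair i]. *)
case/andP => _ /forallP/(_ (stair ord0)) nb; apply/eqP/negbNE/negP => i0.
have i0' : ord0 != i by rewrite eq_sym.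
case/negP: nb; rewrite !lt_neqAle (inj_eq stair_inj) i0' le0x andbT /=.
apply/andP; split.
  apply/eqP => /(congr1 (letter^~ ord0)).
  by rewrite letter_bot letter_stair.
by apply/hoch_leP => j; rewrite !letter_stair;
  case: (leqP j i); case: (leqP j ord0) => //=; lia.
Qed.

(** The atoms among the labels are [atom_word i] for [i] in A, and [stair ord0] when [ord0] lies in
    I. *)
Lemma negE u : neg u = #|twos u| + (ord0 \in block u).
Proof.
have -> : neg u = #|[set label u i | i in [set i in twos u :|: block u
                                         | (i \in twos u) || (i == ord0)]]|.
  apply: eq_card => j; rewrite in_setI Can_label.
  apply/andP/imsetP => [[/imsetP[i iu ->]]|[i]].
    move=> at_i; exists i => //; rewrite inE iu /=; apply: contraLR at_i.
    by rewrite negb_or /label => /andP[/negbTE -> ]; rewrite stair_atoms.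
  rewrite inE => /andP[iu i2] ->; split; first exact: imset_f.
  rewrite /label; case: ifPn i2 => [/twos_neq0/atom_word_atoms ->//|_ /=].
  by rewrite stair_atoms.
rewrite card_imset; last exact: label_inj.
set D := [set i in _ | _]; rewrite -(cardsID (twos u) D).
have -> : D :&: twos u = twos u.
  by apply/setP => i; rewrite !inE; case: eqP; rewrite ?andbF.
congr (_ + _); case: (boolP (ord0 \in block u)) => b0.
  rewrite -[RHS](cards1 (@ord0 n)); apply: eq_card => i.
  rewrite in_setD [i \in D]in_set in_setU in_set1.
  have [->|_] := eqVneq i ord0; first by rewrite b0 orbT twos0.
  by case: (i \in twos u) => //=; rewrite andbF.
apply/eqP; rewrite cards_eq0; apply/eqP/setP => i.
rewrite in_setD [i \in D]in_set in_setU in_set0.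
have [->|_] := eqVneq i ord0; first by rewrite (negbTE b0) (negbTE (twos0 u)).
by case: (i \in twos u) => //=; rewrite andbF.
Qed.

End Words.

(** * The core label order *)

Section CoreLabelOrder.
Context {n : nat}.
Implicit Types (u v w : hoch n.+1) (i j k : 'I_n.+1) (B : {set 'I_n.+1}).

(** * Nuclei and core label sets *)

Lemma nucleus_le_self u : (nucleus u <= u)%O.
Proof.
by rewrite /nucleus; elim/big_rec: _ => [|w x _]; [exact: lexx|exact/le_trans/leIr].
Qed.

Lemma le_nucleus v u :
  (v <= u)%O -> (forall w, covers w u -> v <= w)%O -> (v <= nucleus u)%O.
Proof.
move=> vu vw; rewrite /nucleus; elim/big_rec: _ => // w x /vw vlew vx.
by rewrite lexI vlew.
Qed.

(** A lower cover that keeps the 1 at [j] has no 0 before [j]; one that lowers position [j] keeps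
    the letters up to [i]. This will exclude from [Psi u] the stairs that end before the last 1. *)
Lemma stair_le_nucleus u i j :
  i < j -> letter u j = 1 -> (stair i <= nucleus u)%O.
Proof.
move=> ij uj; have pos v k : letter v j = 1 -> k <= i -> 0 < letter v k.
  move=> vj ki; rewrite lt0n; apply/eqP => vk.
  exact: (letter_after0 (leq_ltn_trans ki ij) vk).
have stairP v : letter v j = 1 -> (stair i <= v)%O.
  move=> vj; apply/hoch_leP => k; rewrite letter_stair.
  by case: (leqP k i) => // /(pos v _ vj).
apply: le_nucleus => [|w]; first exact: stairP.
case/coversE => k ku ->; have [jk|jk] := eqVneq j k; last first.
  by apply: stairP; rewrite letter_lower // (negbTE jk).
apply/hoch_leP => m; rewrite letter_stair letter_lower // -jk.
case: (leqP m i) => // mi; case: ifP => [/eqP mj|_]; last exact: pos.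
by rewrite mj leqNgt ij in mi.
Qed.

Lemma nucleus_letter u k : letter (nucleus u) k <= 1.
Proof.
have [uk|uk] := eqVneq (letter u k) 2; last first.
  have /hoch_leP/(_ k) := nucleus_le_self u.
  by move: uk (letter_lt3 u k); lia.
have ku : k \in twos u :|: block u by rewrite in_setU twosE uk.
have /hoch_leP/(_ k) := nucleus_le (step_covers (step_lower ku)).
rewrite letter_lower // eqxx => /leq_trans -> //; by case: andb.
Qed.

(** The lower cover at the last 1, at position [l], forces a 0 of the nucleus at [l], hence no 1
    after [l]. As the nucleus has no letter 2 and [l <= i], its letters 1 all come before [i]. *)
Lemma nucleus_le_stair u i :
  i \in block u -> (nucleus u <= lower (stair i) i)%O.
Proof.
move=> ib; have u0 : letter u ord0 != 0.
  by rewrite -block_eq0; apply/set0Pn; exists i.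
have [l lu] := last_one u0.
have /setDP[lb l2] : l \in block u :\: twos u by rewrite lu set11.
have li : l <= i.
  have ul : letter u l = 1.
    by move/blockP/(_ l): lb l2 (letter_lt3 u l); rewrite twosE ltnn; lia.
  by rewrite leqNgt; apply/negP => il; move/blockP/(_ l): ib; rewrite il ul.
have lu' : l \in twos u :|: block u by rewrite in_setU lb orbT.
have nl : letter (nucleus u) l = 0.
  have /hoch_leP/(_ l) := nucleus_le (step_covers (step_lower lu')).
  by rewrite letter_lower // eqxx -twosE (negbTE l2) /=; lia.
have ii : i \in twos (stair i) :|: block (stair i).
  by rewrite in_setU mem_block_marked ?inE ?orbT.
apply/hoch_leP => k; rewrite letter_lower // !letter_stair leqnn /=.
have := nucleus_letter u k; case: (ltnP l k) => [lk|kl].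
  by have := letter_after0 lk nl; lia.
case: (ltnP l i) => [li'|il].
  by case: eqP => [ki|_]; [move: kl; rewrite ki leqNgt li' | rewrite (leq_trans kl li)].
have {li il} li : l = i by apply/val_inj/eqP; rewrite eqn_leq li il.
rewrite -li; have [->|_] := eqVneq k l; first by rewrite nl.
by rewrite kl.
Qed.

(** An element of A labels a lower cover of [u]. For [i] in I, [stair i] labels the cover just below
    itself, which lies between the nucleus and [u]. *)
Lemma PsiE u :
  Psi u = [set atom_word i | i in twos u] :|: [set stair i | i in block u].
Proof.
apply/setP => c; rewrite inE in_setU; apply/existsP/idP => [[w /existsP[w']]|].
  case/and4P => nw /coversE[i iw' defw] /hoch_leP lew'u lab; subst w.
  rewrite (is_label_uniq lab (step_label (step_lower iw'))) /label.
  case: ifPn => [i2|ni2].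
    rewrite imset_f // twosE; have := lew'u i; have := letter_lt3 u i.
    by move: i2; rewrite twosE; lia.
  have ib : i \in block w' by move: iw'; rewrite in_setU (negbTE ni2).
  (* A letter 1 of [u] at [j > i] would put [stair i] below the nucleus, hence below [lower w' i],
     whose letter at [i] is 0. *)
  rewrite [X in _ || X]imset_f ?orbT //; apply/blockP => j; case: ltnP => [ij uj|ji].
    have /hoch_leP/(_ i) := le_trans (stair_le_nucleus ij uj) nw.
    by rewrite letter_stair letter_lower // eqxx leqnn -twosE (negbTE ni2).
  by move/blockP/(_ j): ib; have := lew'u j; rewrite ltnNge ji /=; lia.
case/orP => /imsetP[i iu ->].
  have iu' : i \in twos u :|: block u by rewrite in_setU iu.
  exists (lower u i); apply/existsP; exists u.
  have st := step_lower iu'; have lab := step_label st.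
  rewrite /label iu in lab.
  by rewrite (nucleus_le (step_covers st)) (step_covers st) lexx lab.
have ii : i \in twos (stair i) :|: block (stair i).
  by rewrite in_setU mem_block_marked ?inE ?orbT.
exists (lower (stair i) i); apply/existsP; exists (stair i).
have st := step_lower ii; have lab := step_label st.
rewrite /label twos_marked ?inE // in lab.
rewrite nucleus_le_stair // (step_covers st) lab andbT /=.
apply/hoch_leP => j; rewrite letter_stair; case: (leqP j i) => // ji.
by move/blockP/(_ j): iu; rewrite ltnNge ji; case: (letter _ _).
Qed.

Lemma clo_leP u v :
  ((u : clo n.+1) <= (v : clo n.+1))%O =
  (twos u \subset twos v) && (block u \subset block v).
Proof.
have -> : ((u : clo n.+1) <= (v : clo n.+1))%O = (Psi u \subset Psi v) by [].
rewrite !PsiE; apply/idP/andP => [/subsetP le|[tw bl]].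
  split; apply/subsetP => i iu.
    have /le : atom_word i \in [set atom_word i | i in twos u]
                           :|: [set stair i | i in block u].
      by rewrite in_setU imset_f.
    rewrite in_setU => /orP[]/imsetP[j jv].
      by move/(atom_inj (twos_neq0 iu) (twos_neq0 jv)) => ->.
    by move/esym/(stair_neq_atom (twos_neq0 iu)).
  have /le : stair i \in [set atom_word i | i in twos u]
                           :|: [set stair i | i in block u].
    by rewrite in_setU imset_f ?orbT.
  rewrite in_setU => /orP[]/imsetP[j jv]; last by move/stair_inj => ->.
  by move/(stair_neq_atom (twos_neq0 jv)).
by apply: setUSS; apply: imsetS.
Qed.

(** Under inclusion, equal weights force equal sets A and intervals both empty or both nonempty; a
    common element of the intervals then identifies the words by [block_letter]. *)
Lemma weight_lt u v : ((u : clo n.+1) < (v : clo n.+1))%O -> weight u < weight v.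
Proof.
rewrite lt_neqAle clo_leP => /and3P[neq tw bl].
rewrite ltn_neqAle; apply/andP; split; last first.
  rewrite /weight leq_add ?subset_leq_card //.
  rewrite -!block_eq0; case: eqP => //= /eqP/set0Pn[i iu].
  by rewrite (_ : block v != set0) //; apply/set0Pn; exists i; exact: subsetP iu.
apply: contra neq => /eqP; rewrite /weight => eqw.
have le0 : (letter u ord0 != 0) <= (letter v ord0 != 0).
  rewrite -!block_eq0; case: eqP => //= /eqP/set0Pn[i iu].
  by rewrite (_ : block v != set0) //; apply/set0Pn; exists i; exact: subsetP iu.
have := subset_leq_card tw => le2.
have eqt : twos u = twos v by apply/eqP; rewrite eqEcard tw; lia.
have [u0|/last_one[l lu]] := eqVneq (letter u ord0) 0.
  have v0 : letter v ord0 = 0 by lia.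
  by rewrite (unmarked_letter u0) (unmarked_letter v0) eqt.
have /setDP[lb _] : l \in block u :\: twos u by rewrite lu set11.
by rewrite (block_letter lb) (block_letter (subsetP bl _ lb)) eqt.
Qed.

(** A nonempty I is removed by turning every 1 into 0; if I is empty, one letter 2 is turned into
    0. *)
Lemma weight_pred v : 0 < weight v ->
  exists2 w, ((w : clo n.+1) < (v : clo n.+1))%O & weight v = (weight w).+1.
Proof.
move=> v_gt0.
suff [w le eqw] : exists2 w, ((w : clo n.+1) <= (v : clo n.+1))%O &
    weight v = (weight w).+1.
  exists w => //; rewrite lt_neqAle le andbT; apply/eqP => wv.
  by move: eqw; rewrite wv; lia.
have wt B : ord0 \notin B -> weight (unmarked_word B) = #|B|.
  by move=> B0; rewrite /weight twos_unmarked // letter_unmarked // (negbTE B0) addn0.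
have bl B : ord0 \notin B -> block (unmarked_word B) = set0.
  by move=> B0; apply/eqP; rewrite block_eq0 letter_unmarked // (negbTE B0).
have [v0|v0] := eqVneq (letter v ord0) 0; last first.
  exists (unmarked_word (twos v)).
    by rewrite clo_leP bl ?twos0 // twos_unmarked ?twos0 // subxx sub0set.
  by rewrite wt ?twos0 // /weight v0 addn1.
have /set0Pn[i iv] : twos v != set0.
  by move: v_gt0; rewrite /weight v0 addn0 card_gt0.
have B0 : ord0 \notin twos v :\ i.
  by rewrite in_setD negb_and twos0 orbT.
exists (unmarked_word (twos v :\ i)).
  by rewrite clo_leP bl // twos_unmarked // sub0set andbT subsetDl.
by rewrite wt // /weight v0 addn0 (cardsD1 i) iv.
Qed.

(** By [weight_lt] the weight is injective on a chain below [v], with at most [(weight v).+1]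
    values; iterating [weight_pred] gives a chain of that size. *)
Lemma clo_rank v : rank (v : clo n.+1) = weight v.
Proof.
apply/eqP; rewrite eqn_leq; apply/andP; split.
  apply/bigmax_leqP => C /forallP chainC.
  have injC : {in C &, injective
      (fun y : clo n.+1 => inord (weight y) : 'I_(weight v).+1)}.
    move=> y z yC zC; have := chainC y; have := chainC z; rewrite yC zC /=.
    move=> /andP[zv _] /andP[yv /forallP/(_ z)]; rewrite zC /= => cyz.
    have lew x : (x <= (v : clo n.+1))%O -> weight x <= weight v.
      by rewrite le_eqVlt => /predU1P[->//|/weight_lt/ltnW].
    move/(congr1 val); rewrite /= !inordK ?ltnS ?lew // => eqw.
    move: cyz; case: comparableP => // [/weight_lt|/weight_lt]; rewrite eqw ltnn //.
  have : #|C| <= (weight v).+1.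
    by rewrite -(card_in_imset injC) -[leqRHS]card_ord max_card.
  by case: #|C|.
suff [C chainC cardC] : exists2 C : {set clo n.+1},
    [forall y in C, (y <= (v : clo n.+1))%O && [forall z in C, (y >=< z)%O]] &
    #|C| = (weight v).+1.
  by apply: (bigop.bigmax_sup C) => //; rewrite cardC.
have [m] := ubnP (weight v); elim: m v => // m IH v wm.
have [w0|wv_gt0] := posnP (weight v).
  exists [set (v : clo n.+1)]; last by rewrite cards1 w0.
  apply/forallP => y; apply/implyP; rewrite in_set1 => /eqP ->; rewrite lexx /=.
  by apply/forallP => z; apply/implyP; rewrite in_set1 => /eqP ->; exact: comparablexx.
have [w ltwv eqw] := weight_pred wv_gt0.
have [|C /forallP chainC cardC] := IH w; first by rewrite -ltnS -eqw.
have ltC y : y \in C -> (y < (v : clo n.+1))%O.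
  by move=> yC; have := chainC y; rewrite yC => /andP[yw _]; exact: le_lt_trans ltwv.
exists ((v : clo n.+1) |: C); last first.
  rewrite cardsU1 cardC eqw; case: (boolP (_ \in C)) => // /ltC.
  by rewrite ltxx.
apply/forallP => y; apply/implyP; rewrite in_setU1 => /predU1P[->|yC].
  rewrite lexx /=; apply/forallP => z; apply/implyP; rewrite in_setU1.
  case/predU1P => [->|/ltC/ltW zv]; first exact: comparablexx.
  by rewrite comparable_sym le_comparable.
rewrite (ltW (ltC _ yC)) /=; apply/forallP => z; apply/implyP; rewrite in_setU1.
case/predU1P => [->|zC]; first by rewrite le_comparable // ltW // ltC.
by have := chainC y; rewrite yC => /andP[_ /forallP/(_ z)]; rewrite zC.
Qed.

End CoreLabelOrder.

Local Open Scope ring_scope.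

(** * Moebius inversion *)

Section MoebiusInversion.
Context {d : Order.disp_t} {T : finPOrderType d} {R : pzRingType}.
Implicit Types (u v w : T) (f g : T -> R).

Lemma sum_mobius u v : \sum_(w | (w <= v)%O) mobius u w = (u == v)%:R.
Proof.
have mu0 w : ~~ (u <= w)%O -> mobius u w = 0.
  by move=> nuw; rewrite mobiusE (negbTE nuw); case: eqP nuw => // ->; rewrite lexx.
rewrite (bigD1 v) //= mobiusE; case: eqVneq => [<-|uv].
  rewrite big1 ?addr0 // => w /andP[wu nwu]; apply: mu0.
  by apply: contra nwu => uw; rewrite eq_le wu.
case: ifPn => [le_uv|nuv]; last first.
  rewrite add0r big1 // => w /andP[wv _]; apply: mu0.
  by apply: contra nuv => uw; exact: le_trans wv.
apply/eqP; rewrite addrC subr_eq0; apply/eqP.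
rewrite (bigID (fun w => u <= w)%O) /= addrC big1 ?add0r => [|w /andP[_ /mu0 //]].
by apply: eq_bigl => w; rewrite lt_neqAle andbC [(w != v) && _]andbC.
Qed.

Lemma partial_sum_inj f g :
  (forall v, \sum_(w | (w <= v)%O) f w = \sum_(w | (w <= v)%O) g w) -> f =1 g.
Proof.
move=> fg v; have [m] := ubnP #|[set z | (z < v)%O]|; elim: m v => // m IH v vm.
have := fg v; rewrite (bigD1 v) //= [RHS](bigD1 v) //=.
rewrite (_ : \sum_(w | _ && _) f w = \sum_(w | (w <= v)%O && (w != v)) g w).
  exact: addIr.
apply: eq_bigr => w /andP[wv nwv]; have ltwv : (w < v)%O by rewrite lt_neqAle nwv.
apply: IH; apply: leq_trans (proper_card _) (ltnSE vm); apply/properP; split.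
  by apply/subsetP => z; rewrite !inE => /lt_trans; apply.
by exists w; rewrite !inE // ltxx.
Qed.

(** By [sum_mobius], both families in the conclusion sum to [f v] over the ideal of [v], so
    [partial_sum_inj] identifies them. *)
Lemma mobius_inversion f g :
  (forall v, \sum_(w | (w <= v)%O) g w = f v) ->
  forall v, \sum_u (mobius u v)%:~R * f u = g v.
Proof.
move=> fg; apply: partial_sum_inj => v; rewrite exchange_big fg /=.
rewrite (bigD1 v) //= [X in _ + X]big1 => [|u uv].
  by rewrite -mulr_suml -rmorph_sum /= sum_mobius eqxx mul1r addr0.
by rewrite -mulr_suml -rmorph_sum /= sum_mobius (negbTE uv) mul0r.
Qed.

End MoebiusInversion.

(** * Weighted sums over the subsets of a finite set *)

Section SubsetSums.
Context {T : finType} {R : comPzRingType}.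
Implicit Types (A B C : {set T}) (s r : R).

Lemma sum_notin C B : \sum_(i in C) (i \notin B)%:R = #|C :\: B|%:R :> R.
Proof.
rewrite -sum1_card natr_sum big_mkcond [RHS]big_mkcond; apply: eq_bigr => i _.
by rewrite in_setD; case: (i \in B); case: (i \in C).
Qed.

Lemma sum_subset_exp A s r :
  \sum_(B : {set T} | B \subset A) s ^+ #|B| * r ^+ (#|A| - #|B|) = (s + r) ^+ #|A|.
Proof.
(* Outside [A] the factor is [0 + 1]: when the product is expanded, a set not contained in [A]
   contributes 0. *)
have -> : (s + r) ^+ #|A| =
    \prod_i ((if i \in A then s else 0) + (if i \in A then r else 1)).
  rewrite (bigID (mem A)) /= [X in _ * X]big1 ?mulr1 => [|i /negbTE ->];
    last by rewrite add0r.
  by rewrite -prodr_const; apply: eq_bigr => i ->.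
rewrite bigA_distr big_mkcond /=; apply: eq_bigr => B _.
case: ifPn => [BA|/subsetPn[i iB niA]]; last first.
  by rewrite (bigD1 i) //= iB (negbTE niA) mul0r.
rewrite (bigID (mem B)) /=; congr (_ * _).
  rewrite -prodr_const; apply: eq_bigr => i iB.
  by rewrite iB (subsetP BA).
have <- : #|A :\: B| = (#|A| - #|B|)%N by rewrite cardsD (setIidPr BA).
rewrite -prodr_const big_mkcond [RHS]big_mkcond; apply: eq_bigr => i _.
by rewrite in_setD /= ; case: (i \in B) => //=; case: (i \in A).
Qed.

(** The subsets of [A] that avoid [i] are those of [A :\ i], each with one more factor [r]. *)
Lemma sum_subset_notin A i s r : i \in A ->
  \sum_(B : {set T} | B \subset A) (i \notin B)%:R * (s ^+ #|B| * r ^+ (#|A| - #|B|)) =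
  r * (s + r) ^+ #|A|.-1.
Proof.
move=> iA; have cardA : #|A| = #|A :\ i|.+1 by rewrite (cardsD1 i) iA.
rewrite cardA /= -sum_subset_exp mulr_sumr big_mkcond [RHS]big_mkcond.
apply: eq_bigr => B _; rewrite subsetD1.
case: ifPn => //= BA; case: ifPn => [iB|_]; last by rewrite mul0r.
have leB : (#|B| <= #|A :\ i|)%N by rewrite subset_leq_card // subsetD1 BA.
by rewrite mul1r subSn // exprS mulrCA.
Qed.

(** [C :\: B] is counted point by point: a point of [C] outside [A] is never in [B], and one inside
    [A] falls under [sum_subset_notin]. *)
Lemma sum_subset_mul_cardD A C s r :
  \sum_(B : {set T} | B \subset A) #|C :\: B|%:R * (s ^+ #|B| * r ^+ (#|A| - #|B|)) =
  #|C :\: A|%:R * (s + r) ^+ #|A| + #|C :&: A|%:R * (r * (s + r) ^+ #|A|.-1).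
Proof.
under eq_bigr => B _ do rewrite -sum_notin mulr_suml.
rewrite exchange_big /= (bigID (mem A)) /= addrC; congr (_ + _).
  rewrite (eq_bigr (fun=> (s + r) ^+ #|A|)) => [|i /andP[_ niA]].
    by rewrite sumr_const mulr_natl; congr (_ *+ _); apply: eq_card => i; rewrite !inE andbC.
  rewrite -sum_subset_exp; apply: eq_bigr => B BA.
  by rewrite (contra (subsetP BA i) niA) mul1r.
rewrite (eq_bigr (fun=> r * (s + r) ^+ #|A|.-1)) => [|i /andP[_ iA]].
  by rewrite sumr_const mulr_natl; congr (_ *+ _); apply: eq_card => i; rewrite !inE.
exact: sum_subset_notin.
Qed.

End SubsetSums.

(** * Sums over ideals of the core label order *)

Section HochSums.
Context {n : nat}.
Implicit Types (u v w : hoch n.+1) (i j : 'I_n.+1) (B : {set 'I_n.+1}).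
Local Notation le_clo u v := ((u : clo n.+1) <= (v : clo n.+1))%O.

(** Inclusion of the intervals is automatic: if [j] is in that of [marked_word B i], then
    [(j < k) = (i < k)] for every [k] outside [B], and [v] has letter 2 on [B]. *)
Lemma marked_word_le v B i : ord0 \notin B -> i \in block v ->
  le_clo (marked_word B i) v = (B \subset twos v).
Proof.
move=> B0 iv; rewrite clo_leP twos_marked //; apply: andb_idr => /subsetP Bv.
have v2 j : j \in B -> letter v j = 2%N by move/Bv; rewrite twosE => /eqP.
apply/subsetP => j /blockP jb; apply/blockP => k.
move/blockP/(_ k): iv; have := jb k; rewrite letter_marked //.
case: ifP => [/v2 ->|_]; first by case: (_ < _)%N.
by do 2!case: ltnP => _.
Qed.

(** For fixed [i] in [block v], [twos] and [marked_word] are inverse bijections between the words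
    below [v] whose interval contains [i] and the subsets of [twos v]. *)
Lemma sum_marked {V : nmodType} (h : {set 'I_n.+1} -> 'I_n.+1 -> V) v :
  \sum_(w : clo n.+1 | (w <= (v : clo n.+1))%O) \sum_(i in block w) h (twos w) i =
  \sum_(B : {set 'I_n.+1} | B \subset twos v) \sum_(i in block v) h B i.
Proof.
rewrite (exchange_big_dep xpredT) //= [RHS]exchange_big /= [RHS]big_mkcond /=.
apply: eq_bigr => i _; case: ifPn => [iv|niv]; last first.
  rewrite big1 // => w /andP[]; rewrite clo_leP => /andP[_ /subsetP bl] /bl.
  by rewrite (negbTE niv).
rewrite (reindex_onto (fun B => marked_word B i) twos) /=
  => [|w /andP[_ /block_letter <-] //].
have eqB B : (le_clo (marked_word B i) v && (i \in block (marked_word B i))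
              && (twos (marked_word B i) == B)) = (B \subset twos v).
  (* For [ord0] in [B] both sides are false, since no set [twos] contains [ord0]. *)
  have [B0|B0] := boolP (ord0 \in B).
    rewrite [RHS](contraNF _ (twos0 v)) => [|/subsetP -> //].
    by apply/negP => /andP[_ /eqP eqB]; have := twos0 (marked_word B i); rewrite eqB B0.
  by rewrite twos_marked // eqxx marked_word_le // mem_block_marked // !andbT.
rewrite (eq_bigl _ _ eqB); apply: eq_bigr => B Bv; rewrite twos_marked //.
by apply: contra (twos0 v); exact: (subsetP Bv).
Qed.

Lemma sum_unmarked {V : nmodType} (h : {set 'I_n.+1} -> V) v :
  \sum_(w : clo n.+1 | (w <= (v : clo n.+1))%O && (letter w ord0 == 0)) h (twos w) =
  \sum_(B : {set 'I_n.+1} | B \subset twos v) h B.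
Proof.
rewrite (reindex_onto (fun B => unmarked_word B) twos) /=
  => [|w /andP[_ /eqP/unmarked_letter <-] //].
have bl0 B : ord0 \notin B -> block (unmarked_word B) = set0.
  by move=> B0; apply/eqP; rewrite block_eq0 letter_unmarked // (negbTE B0).
have eqB B : (le_clo (unmarked_word B) v && (letter (unmarked_word B) ord0 == 0)
              && (twos (unmarked_word B) == B)) = (B \subset twos v).
  have [B0|B0] := boolP (ord0 \in B).
    rewrite [RHS](contraNF _ (twos0 v)) => [|/subsetP -> //].
    by apply/negP => /andP[_ /eqP eqB]; have := twos0 (unmarked_word B); rewrite eqB B0.
  rewrite clo_leP twos_unmarked // eqxx bl0 // sub0set letter_unmarked // (negbTE B0).
  by rewrite !andbT.
rewrite (eq_bigl _ _ eqB); apply: eq_bigr => B Bv; rewrite twos_unmarked //.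
by apply: contra (twos0 v); exact: (subsetP Bv).
Qed.

(** The word 12...2 is greatest in the core label order, so sums over all words are sums over its
    ideal. *)
Definition clo_top : hoch n.+1 := marked_word [set~ ord0] ord0.

Lemma twos_clo_top : twos clo_top = [set~ ord0].
Proof. by rewrite twos_marked // !inE eqxx. Qed.

Lemma block_clo_top : block clo_top = setT.
Proof.
apply/setP => i; rewrite in_setT; apply/blockP => j.
rewrite letter_marked ?in_setC1 ?eqxx //.
by have [->|_] := eqVneq j ord0 => /=; case: (_ < _)%N.
Qed.

Lemma le_clo_top u : le_clo u clo_top.
Proof.
rewrite clo_leP twos_clo_top block_clo_top subsetT andbT.
by apply/subsetP => i; rewrite in_setC1; exact: twos_neq0.
Qed.

Lemma sum_marked_all {V : nmodType} (h : {set 'I_n.+1} -> 'I_n.+1 -> V) :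
  \sum_(w : hoch n.+1) \sum_(i in block w) h (twos w) i =
  \sum_(B : {set 'I_n.+1} | B \subset [set~ ord0]) \sum_i h B i.
Proof.
transitivity (\sum_(w : clo n.+1 | (w <= (clo_top : clo n.+1))%O)
                \sum_(i in block w) h (twos w) i).
  by apply: eq_bigl => w; rewrite le_clo_top.
rewrite sum_marked twos_clo_top; apply: eq_bigr => B _.
by apply: eq_bigl => i; rewrite block_clo_top in_setT.
Qed.

Lemma sum_unmarked_all {V : nmodType} (h : {set 'I_n.+1} -> V) :
  \sum_(w : hoch n.+1 | letter w ord0 == 0) h (twos w) =
  \sum_(B : {set 'I_n.+1} | B \subset [set~ ord0]) h B.
Proof.
rewrite -twos_clo_top -sum_unmarked; apply: eq_bigl => w.
by rewrite le_clo_top.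
Qed.

End HochSums.

(** * The family chi_v and its sums over ideals *)

Section CharacteristicPolynomial.
Context {n : nat} {R : comNzRingType}.
Implicit Types (u v w : hoch n.+1) (i j : 'I_n.+1) (B : {set 'I_n.+1}) (t : R).

(** This is chi_v, with [t - #|block v|] spread over the positions of I so that [sum_marked]
    applies: a nonempty I has exactly one element outside A. *)
Definition clo_char t v : R :=
  (t - 1) ^+ #|twos v| *
  ((letter v ord0 == 0)%:R + \sum_(i in block v) ((i \notin twos v)%:R * t - 1)).

Lemma sum_clo_char t v :
  \sum_(w : clo n.+1 | (w <= (v : clo n.+1))%O) clo_char t w = t ^+ rank (v : clo n.+1).
Proof.
pose h B i := (t - 1) ^+ #|B| * ((i \notin B)%:R * t - 1).
have charE w : clo_char t w = (if letter w ord0 == 0 then (t - 1) ^+ #|twos w| else 0)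
                              + \sum_(i in block w) h (twos w) i.
  rewrite /clo_char mulrDr mulr_sumr; congr (_ + _).
  by case: eqP => _; rewrite ?mulr1 ?mulr0.
under eq_bigr => w _ do rewrite charE.
rewrite big_split /= sum_marked -big_mkcondr (sum_unmarked (fun B => (t - 1) ^+ #|B|)).
have exp1 (A : {set 'I_n.+1}) :
  \sum_(B : {set 'I_n.+1} | B \subset A) (t - 1) ^+ #|B| = t ^+ #|A|.
  rewrite -[t in RHS](subrK 1) -sum_subset_exp; apply: eq_bigr => B _.
  by rewrite expr1n mulr1.
have hE B : \sum_(i in block v) h B i =
    t * (#|block v :\: B|%:R * ((t - 1) ^+ #|B| * 1 ^+ (#|twos v| - #|B|)))
                - #|block v|%:R * (t - 1) ^+ #|B|.
  rewrite /h -mulr_sumr big_split /= -mulr_suml sum_notin sumr_const expr1n.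
  by rewrite mulNrn; ring.
under [X in _ + X]eq_bigr => B _ do rewrite hE.
rewrite exp1 sumrB -!mulr_sumr exp1 sum_subset_mul_cardD subrK card_blockD.
rewrite -(cardsID (twos v) (block v)) card_blockD natrD clo_rank /weight exprD mul1r.
(* The exponent [.-1] is truncated when [twos v] is empty, but then the coefficient is 0. *)
have tE : #|block v :&: twos v|%:R * (t * t ^+ #|twos v|.-1) =
    #|block v :&: twos v|%:R * t ^+ #|twos v|.
  case: (posnP #|twos v|) => [t0|t_gt0]; last by rewrite -exprS prednK.
  have : (#|block v :&: twos v| <= #|twos v|)%N by rewrite subset_leq_card // subsetIr.
  by rewrite t0 leqn0 => /eqP ->; rewrite !mul0r.
rewrite mulrDr [t * (#|_|%:R * _)]mulrCA tE.
by case: (_ != 0%N) => /=; rewrite ?expr0 ?expr1; ring.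
Qed.

Lemma sum_mobius_rank t v :
  \sum_(u : clo n.+1) (mobius u (v : clo n.+1))%:~R * t ^+ rank u = clo_char t v.
Proof.
have inv := @mobius_inversion _ (clo n.+1) R (fun w : clo n.+1 => t ^+ rank w) (clo_char t).
exact: inv (sum_clo_char t) v.
Qed.

End CharacteristicPolynomial.

(** * The H-triangle *)

Section HTriangle.
Context {n : nat} {F : fieldType}.
Implicit Types (x y : F).

Lemma card_setC_ord0 : #|[set~ (ord0 : 'I_n.+1)]| = n.
Proof. by rewrite cardsC1 card_ord. Qed.

Lemma cardC_setC_ord0 : #|[set: 'I_n.+1] :\: [set~ ord0]| = 1%N.
Proof. by rewrite setTD setCK cards1. Qed.

Lemma sum_Can_neg x y :
  \sum_(u : hoch n.+1) x ^+ #|Can u| * y ^+ neg u =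
  (1 + x * y) ^+ n.+1 + n%:R * x * (1 + x * y) ^+ n.-1.
Proof.
(* Summed over a nonempty I, the last factor gives 1 for the single element outside A, plus [y - 1]
   if [ord0] lies in I: that is [y] or 1, as [negE] requires. *)
pose h (B : {set 'I_n.+1}) (i : 'I_n.+1) : F :=
  x * (x * y) ^+ #|B| * ((i \notin B)%:R + (i == ord0)%:R * (y - 1)).
have termE (u : hoch n.+1) : x ^+ #|Can u| * y ^+ neg u =
    (if letter u ord0 == 0%N then (x * y) ^+ #|twos u| else 0)
    + \sum_(i in block u) h (twos u) i.
  have s0 : \sum_(i in block u) (i == ord0)%:R = (ord0 \in block u)%:R :> F.
    rewrite big_mkcond (bigD1 ord0) //= big1 ?addr0 => [|i /negbTE ->]; last by case: ifP.
    by case: (_ \in _).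
  rewrite /h -mulr_sumr big_split /= -mulr_suml sum_notin s0 card_blockD.
  rewrite card_Can negE /weight.
  have [u0|u0] := eqVneq (letter u ord0) 0%N.
    have /eqP -> : block u == set0 by rewrite block_eq0 u0.
    by rewrite inE !addn0 exprMn /=; ring.
  by case: (_ \in _) => /=; rewrite ?addn0 !exprD exprMn /=; ring.
under eq_bigr => u _ do rewrite termE.
rewrite big_split /= -big_mkcond sum_marked_all (sum_unmarked_all (fun B => (x * y) ^+ #|B|)).
pose g (B : {set 'I_n.+1}) : F :=
  (x * y) ^+ #|B| * 1 ^+ (#|[set~ (ord0 : 'I_n.+1)]| - #|B|).
have hE (B : {set 'I_n.+1}) : \sum_i h B i =
    x * (#|[set: 'I_n.+1] :\: B|%:R * g B) + x * (y - 1) * g B.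
  rewrite /h /g -mulr_sumr big_split /= -mulr_suml expr1n -sum_notin.
  have -> : \sum_(i < n.+1) (i == ord0)%:R = 1 :> F.
    by rewrite (bigD1 ord0) //= big1 ?addr0 // => i /negbTE ->.
  under [in RHS]eq_bigl => i do rewrite in_setT.
  by ring.
under [X in _ + X]eq_bigr => B _ do rewrite hE.
rewrite (eq_bigr g) => [|B _]; last by rewrite /g expr1n mulr1.
rewrite big_split /= -!mulr_sumr sum_subset_mul_cardD sum_subset_exp.
rewrite cardC_setC_ord0 setTI card_setC_ord0 exprS (addrC 1 (x * y)).
by ring.
Qed.

Lemma Htriangle_closed_form x y : y != 1 -> x * (y - 1) + 1 != 0 ->
  Htriangle n.+1 x y = (1 + x * y) ^+ n.+1 + n%:R * x * (1 + x * y) ^+ n.-1.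
Proof.
rewrite -subr_eq0 => y1 p0; rewrite /Htriangle /Mtriangle exchange_big /=.
(* Then [X * (t - 1) = x] and [X * t = x * y], which clears the denominators once [p ^+ n.+1] is
   distributed over the terms. *)
set t := y / (y - 1); set X := x * (y - 1) in p0 *; set p := X + 1 in p0 *.
have tE : t - 1 = (y - 1)^-1 by rewrite /t; field.
have Xt : X * (t - 1) = x by rewrite tE /X mulfK.
have Xt' : X * t = x * y by rewrite /X /t; field.
pose h (B : {set 'I_n.+1}) (i : 'I_n.+1) : F :=
  (x ^+ #|B| * p ^+ (n - #|B|)) * ((i \notin B)%:R * (x * y) - X).
have termE (v : hoch n.+1) :
    p ^+ n.+1 * \sum_(u : clo n.+1)
      (mobius u (v : clo n.+1))%:~R * t ^+ rank u * (X / p) ^+ rank (v : clo n.+1)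
    = (if letter v ord0 == 0%N
       then p * (x ^+ #|twos v| * p ^+ (n - #|twos v|)) else 0)
      + \sum_(i in block v) h (twos v) i.
  rewrite -mulr_suml sum_mobius_rank clo_rank /weight /clo_char.
  (* The first letter is never 2, so the subtraction [n - #|twos v|] is exact. *)
  have a_le : (#|twos v| <= n)%N.
    rewrite -[leqRHS]card_setC_ord0 subset_leq_card //.
    by apply/subsetP => i; rewrite in_setC1; exact: twos_neq0.
  have pE : p ^+ n * ((t - 1) ^+ #|twos v| * (X / p) ^+ #|twos v|) =
            x ^+ #|twos v| * p ^+ (n - #|twos v|).
    rewrite -exprMn mulrA (mulrC _ X) Xt exprMn exprVn mulrCA; congr (_ * _).
    by rewrite expfB_cond ?(negbTE p0) ?andbF // .
  have [v0|v0] := eqVneq (letter v ord0) 0%N.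
    have /eqP bl0 : block v == set0 by rewrite block_eq0 v0.
    by rewrite bl0 !big_set0 !addr0 addn0 -pE exprS mulr1 -!mulrA.
  have -> : \sum_(i in block v) h (twos v) i =
      x ^+ #|twos v| * p ^+ (n - #|twos v|) *
      (X * \sum_(i in block v) ((i \notin twos v)%:R * t - 1)).
    rewrite [X * _]mulr_sumr mulr_sumr; apply: eq_bigr => i _.
    by rewrite /h -Xt'; ring.
  rewrite -pE add0r exprD expr1 exprS.
  move: (p ^+ n) ((t - 1) ^+ _) ((X / p) ^+ _) => a b c.
  by field.
rewrite mulr_sumr (eq_bigr _ (fun v _ => termE v)).
rewrite big_split /= -big_mkcond.
rewrite (sum_marked_all h) (sum_unmarked_all (fun B => p * (x ^+ #|B| * p ^+ (n - #|B|)))).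
pose g (B : {set 'I_n.+1}) : F := x ^+ #|B| * p ^+ (#|[set~ (ord0 : 'I_n.+1)]| - #|B|).
have hE (B : {set 'I_n.+1}) : \sum_i h B i =
    x * y * (#|[set: 'I_n.+1] :\: B|%:R * g B) - n.+1%:R * X * g B.
  rewrite /h /g -mulr_sumr big_split /= -mulr_suml -sum_notin card_setC_ord0.
  under [in RHS]eq_bigl => i do rewrite in_setT.
  by rewrite sumr_const card_ord -mulr_natl; ring.
under [X in _ + X]eq_bigr => B _ do rewrite hE.
rewrite (eq_bigr (fun B => p * g B)) => [|B _]; last by rewrite /g card_setC_ord0.
rewrite sumrB -!mulr_sumr sum_subset_mul_cardD sum_subset_exp.
rewrite cardC_setC_ord0 setTI card_setC_ord0.
have -> : x + p = 1 + x * y by rewrite /p /X; ring.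
(* For [n = 0] the exponent [n.-1] is truncated, and its coefficient is 0. *)
case: n => [|m] /=; first by rewrite !expr0 expr1 /p /X; ring.
by rewrite !exprS -natr1 /p /X; ring.
Qed.

End HTriangle.

Theorem proposition6p17 (n : nat) (hn : (0 < n)%N) :
  Htriangle n varx vary =
  \sum_(u : hoch n) varx ^+ #|Can u| * vary ^+ neg u.
Proof.
case: n hn => // n _; rewrite sum_Can_neg Htriangle_closed_form //.
  (* The polynomials y and 1 differ in their coefficient of degree 1. *)
  rewrite /vary -tofrac1 tofrac_eq; apply/eqP.
  move=> /(congr1 (fun p : {poly {poly int}} => p`_1)) /eqP.
  by rewrite coefX coef1 oner_eq0.
(* At y = 1, the outer variable, the polynomial x(y - 1) + 1 takes the value 1, so it is nonzero. *)
rewrite /varx /vary -!tofrac1 -tofracB -tofracM -tofracD tofrac_eq0.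
apply/eqP => /(congr1 (fun p : {poly {poly int}} => p.[1])) /eqP.
by rewrite !hornerE subrr mulr0 add0r oner_eq0.
Qed.
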